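(* Let $k\in\mathbb{Z}^+$ and let $G_i=(V_i,E_i)$, $1\leq i\leq k$, be 3-balanced graphs with $V_i\cap V_j=\{v_0\}$ for $1\leq i<j\leq k$. Then $G=\left(\bigcup_{i=1}^kV_i,\ \bigcup_{i=1}^kE_i\right)$ is 3-balanced.
   Context: A graph is 3-balanced if it admits a vertex coloring $\ell:V\to\mathbb{Z}_3$ such that every vertex has, in its open neighborhood, the same number of vertices of each of the three colors. *)

(* Defs.v *)
From mathcomp Require Import all_boot all_algebra.

Set Implicit Arguments.
Unset Strict Implicit.
Unset Printing Implicit Defensive.

(* Finite simple graphs (V, E) whose vertices are drawn from a common ambient
   finite type T, so that the vertex sets of different graphs may overlap;
   edges are two-element subsets of V. *)
Record sgraph (T : finType) := SGraph {
  vertices : {set T};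
  edges : {set {set T}};
  edges_valid : forall e, e \in edges -> (e \subset vertices) && (#|e| == 2)
}.

Definition open_nbhd (T : finType) (G : sgraph T) (v : T) : {set T} :=
  [set u | [set v; u] \in edges G].

(* The colouring l is a total function on T, but only its values on
   [vertices G] matter, since open neighbourhoods lie inside [vertices G].
   It is not required to be proper. *)
Definition balanced3 (T : finType) (G : sgraph T) : Prop :=
  exists l : T -> 'Z_3, forall v, v \in vertices G ->
    forall a b : 'Z_3,
      #|[set u in open_nbhd G v | l u == a]| =
      #|[set u in open_nbhd G v | l u == b]|.

Lemma union_edges_valid (T : finType) (k : nat) (G : 'I_k -> sgraph T) e :
  e \in \bigcup_(i < k) edges (G i) ->
  (e \subset \bigcup_(i < k) vertices (G i)) && (#|e| == 2).
Proof.
case/bigcupP=> i _ /edges_valid/andP[sub_e ->]; rewrite andbT.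
exact: subset_trans sub_e (bigcup_sup i _).
Qed.

Definition union_graph (T : finType) (k : nat) (G : 'I_k -> sgraph T) :
    sgraph T :=
  SGraph (union_edges_valid (G := G)).

(* Main.v *)
Require Import Defs.
From mathcomp Require Import all_boot all_algebra.

(** Translating a balanced colouring by a constant of Z_3 keeps it balanced, so
    every G_i has a balanced colouring giving v_0 the colour 0, and these glue
    to a colouring of the union. Since the G_i pairwise share only the vertex
    v_0 they share no edge, so a neighbourhood in the union is the disjoint
    union of the neighbourhoods in the G_i, each of which is balanced (or
    empty, when the vertex is not in G_i). *)

Import GRing.Theory.

Definition balanced3_coloring {T : finType} (G : sgraph T) (l : T -> 'Z_3) :=
  forall v, v \in vertices G -> forall a b : 'Z_3,
    #|[set u in open_nbhd G v | l u == a]| =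
    #|[set u in open_nbhd G v | l u == b]|.

Lemma open_nbhd_vertices {T : finType} {G : sgraph T} {u v : T} :
  u \in open_nbhd G v -> [/\ v \in vertices G, u \in vertices G & v != u].
Proof.
rewrite inE => /edges_valid/andP[/subsetP sub_vu]; rewrite cards2.
by case: (v =P u) => // _ _; rewrite !sub_vu ?set21 ?set22.
Qed.

Lemma open_nbhd_union {T : finType} {k : nat} (G : 'I_k -> sgraph T) (v : T) :
  open_nbhd (union_graph G) v = \bigcup_(i < k) open_nbhd (G i) v.
Proof.
apply/setP=> u; rewrite inE; apply/bigcupP/bigcupP=> -[i _ uv]; exists i => //.
  by rewrite inE.
by move: uv; rewrite inE.
Qed.

(** Subtracting [c] only permutes the colour classes within each neighbourhood, and balance compares
    every pair of classes. *)
Lemma balanced3_coloring_shift {T : finType} {G : sgraph T} {l} (c : 'Z_3) :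
  balanced3_coloring G l -> balanced3_coloring G (fun u => l u - c)%R.
Proof.
have shift v a : [set u in open_nbhd G v | (l u - c)%R == a]
              = [set u in open_nbhd G v | l u == (a + c)%R].
  by apply/setP=> u; rewrite !inE subr_eq.
by move=> bal v Gv a b; rewrite !shift; apply: bal.
Qed.

Lemma balanced3_pointed {T : finType} {G : sgraph T} (v0 : T) :
  balanced3 G -> exists l, balanced3_coloring G l /\ l v0 = 0%R.
Proof.
case=> l bal; exists (fun u => l u - l v0)%R; split; last exact: subrr.
exact: balanced3_coloring_shift.
Qed.

(** Disjointness is asked of neighbourhoods rather than of vertex sets, since the latter may
    overlap; it is what makes colour counts around [v] add up over the graphs. *)
Lemma balanced3_coloring_union {T : finType} {k : nat} {G : 'I_k -> sgraph T}
    {l : T -> 'Z_3} :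
  (forall i j v, i != j -> [disjoint open_nbhd (G i) v & open_nbhd (G j) v]) ->
  (forall i, balanced3_coloring (G i) l) ->
  balanced3_coloring (union_graph G) l.
Proof.
move=> disj bal v _.
have card_color a : #|[set u in open_nbhd (union_graph G) v | l u == a]|
    = \sum_(i < k) #|[set u in open_nbhd (G i) v | l u == a]|.
  have sub i : [set u in open_nbhd (G i) v | l u == a] \subset open_nbhd (G i) v.
    by apply/subsetP=> u /setIdP[].
  have -> : [set u in open_nbhd (union_graph G) v | l u == a]
          = \bigcup_(i < k) [set u in open_nbhd (G i) v | l u == a].
    apply/setP=> u; rewrite in_set open_nbhd_union.
    apply/andP/bigcupP=> [[/bigcupP[i _ uv] la]|[i _ /setIdP[uv la]]].
      by exists i => //; apply/setIdP.
    by split=> //; apply/bigcupP; exists i.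
  rewrite -sum1_card partition_disjoint_bigcup => [|i j ij].
    by apply: eq_bigr => i _; rewrite sum1_card.
  exact: disjointWl (sub i) (disjointWr (sub j) (disj i j v ij)).
move=> a b; rewrite !card_color; apply: eq_bigr => i _.
(* Balance of [G i] says nothing about a vertex outside [G i]; there the neighbourhood is empty and
   every count is 0. *)
have [Giv|nGiv] := boolP (v \in vertices (G i)); first exact: bal.
have empty c : [set u in open_nbhd (G i) v | l u == c] = set0.
  apply/setP=> u; rewrite in_set in_set0; apply/negP=> /andP[].
  by case/open_nbhd_vertices; rewrite (negPf nGiv).
by rewrite !empty.
Qed.

(** Neighbourhoods lie inside the vertex set, so values elsewhere never enter the counts. This lets
    a glued colouring replace the one chosen for each graph. *)
Lemma eq_balanced3_coloring {T : finType} {G : sgraph T} {l l' : T -> 'Z_3} :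
  {in vertices G, l =1 l'} ->
  balanced3_coloring G l -> balanced3_coloring G l'.
Proof.
move=> eq_l.
have eq_set v a : [set u in open_nbhd G v | l' u == a]
                = [set u in open_nbhd G v | l u == a].
  apply: eq_finset => u /=; apply: andb_id2l.
  by move=> /open_nbhd_vertices[_ Gu _]; rewrite eq_l.
by move=> bal v Gv a b; rewrite !eq_set; apply: bal.
Qed.

Theorem theorem6p3 (T : finType) (k : nat) (hk : 0 < k)
    (G : 'I_k -> sgraph T) (v0 : T)
    (hbal : forall i : 'I_k, balanced3 (G i))
    (hmeet : forall i j : 'I_k, i < j ->
       vertices (G i) :&: vertices (G j) = [set v0]) :
  balanced3 (union_graph G).
Proof.
have meet i j u : i != j -> u \in vertices (G i) -> u \in vertices (G j) -> u = v0.
  move=> ij Giu Gju; apply/set1P; have [lt_ij|lt_ji|/val_inj eq_ij] := ltngtP i j.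
  - by rewrite -(hmeet i j lt_ij) inE Giu.
  - by rewrite -(hmeet j i lt_ji) inE Giu Gju.
  - by rewrite eq_ij eqxx in ij.
have [L balL] := fin_all_exists (fun i => balanced3_pointed v0 (hbal i)).
(* Which graph [pick] returns is immaterial: a vertex lying in two of them is [v0], where every
   [L i] is 0. The default colours only points outside all the graphs. *)
pose l u := if [pick i | u \in vertices (G i)] is Some i then L i u else 0%R.
have lE i : {in vertices (G i), L i =1 l}.
  move=> u Giu; rewrite /l; case: pickP => [j Gju|/(_ i)]; last by rewrite Giu.
  have [-> //|ij] := eqVneq i j.
  by rewrite (meet i j u ij Giu Gju) (balL i).2 (balL j).2.
exists l; apply: balanced3_coloring_union => [i j v ij|i].
  (* A common neighbour [u] of [v] would put both ends of an edge in two graphs, forcing [u] and [v]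
     to be [v0], although they are distinct. *)
  apply/pred0P=> u; apply/negP=> /andP[/open_nbhd_vertices[Giv Giu vu]].
  case/open_nbhd_vertices=> Gjv Gju _; case/eqP: vu.
  by rewrite (meet i j v ij Giv Gjv) (meet i j u ij Giu Gju).
exact: eq_balanced3_coloring (lE i) (balL i).1.
Qed.
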